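(* Let $K$ be a field, let $\mathcal A\subseteq M_{\alpha,d}$ define the simplicial toric ideal $I_{\mathcal A}\subset K[x_1,\dots,x_c,y_1,\dots,y_d]$, and let $S$ be the semigroup generated by $\mathcal A$. Assume that $\deg K[S]=\alpha^{d-1}$ and $\alpha\le d-1$. Then the maximum degree in a minimal Gröbner basis of $I_{\mathcal A}$ with respect to the reverse lexicographic order is at most $\deg K[S]-\operatorname{codim}K[S]+1$.
   Context: Setting. $K$ is an arbitrary field, $c\ge 2$, $\alpha\ge 2$ and $d$ are natural numbers, and $M_{\alpha,d}=\{(x_1,\dots,x_d)\in\mathbb N^d : x_1+\cdots+x_d=\alpha\}$ (with $0\in\mathbb N$). $\mathcal A=\{\mathbf e_1,\dots,\mathbf e_d,\mathbf a_1,\dots,\mathbf a_c\}\subseteq M_{\alpha,d}$ is a set of $d+c$ distinct elements, where $\mathbf e_1=(\alpha,0,\dots,0),\dots,\mathbf e_d=(0,\dots,0,\alpha)$. Writing $\mathbf a_i=(a_{i1},\dots,a_{id})$, the integers $a_{ij}$ ($1\le i\le c$, $1\le j\le d$) are assumed to be relatively prime (their overall gcd is $1$). $S\subseteq\mathbb N^d$ is the (homogeneous simplicial affine) semigroup (with $0$) generated by $\mathcal A$, and $K[S]\cong K[t_1^\alpha,\dots,t_d^\alpha,\mathbf t^{\mathbf a_1},\dots,\mathbf t^{\mathbf a_c}]\subseteq K[t_1,\dots,t_d]$, where $\mathbf t^{\mathbf a_i}=t_1^{a_{i1}}\cdots t_d^{a_{id}}$. $I_{\mathcal A}$ is the kernel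 of the $K$-algebra homomorphism $K[x_1,\dots,x_c,y_1,\dots,y_d]\to K[S]$, $x_i\mapsto \mathbf t^{\mathbf a_i}$, $y_j\mapsto t_j^\alpha$; it is called the simplicial toric ideal defined by $\mathcal A$. The grading is the standard one: $\deg x_i=\deg y_j=1$. One has $\dim K[S]=d$ and $\operatorname{codim}K[S]=c$; $\deg K[S]$ is the multiplicity of the standard graded algebra $K[S]$. Order. The reverse lexicographic order is the graded (degree) reverse lexicographic order with $x_1>\cdots>x_c>y_1>\cdots>y_d$. The maximum degree in a minimal Gröbner basis of $I_{\mathcal A}$ is the largest degree of a minimal generator of the initial ideal $\operatorname{in}(I_{\mathcal A})$. *)

(* Defs.v *)
From HB Require Import structures.
From mathcomp Require Import all_boot all_order all_algebra.
From mathcomp Require Import mpoly.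

Set Implicit Arguments.
Unset Strict Implicit.
Unset Printing Implicit Defensive.

Import GRing.Theory Num.Theory.
Local Open Scope ring_scope.

(* The variables x_1, ..., x_c, y_1, ..., y_d are indexed in this order by
   'I_(c + d): x_i is lshift d i and y_j is rshift c j. *)

(* The set A as a family indexed by the variables:
   x_i |-> a_i  and  y_j |-> e_j = (0, .., alpha, .., 0). *)
Definition generators (c d alpha : nat) (a : 'I_c -> 'X_{1..d})
    (k : 'I_(c + d)) : 'X_{1..d} :=
  match split k with
  | inl i => a i
  | inr j => (U_(j) *+ alpha)%MM
  end.

(* K[S] is the image of this map, and is represented below as the quotient of
   {mpoly K[c + d]} by its kernel. *)
Definition toric_map (K : fieldType) (c d alpha : nat) (a : 'I_c -> 'X_{1..d})
    (f : {mpoly K[c + d]}) : {mpoly K[d]} :=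
  f \mPo [tuple 'X_[generators alpha a k] | k < c + d].

Definition toric_ideal (K : fieldType) (c d alpha : nat)
    (a : 'I_c -> 'X_{1..d}) : {pred {mpoly K[c + d]}} :=
  [pred f | toric_map alpha a f == 0].

Arguments toric_ideal K {c d} alpha a.

(* The order (m1 < m2)%O of the multinomials library (used by mlead) is the
   degree-lexicographic one.  Here the variable of index 0 is the largest. *)
Definition degrevlex_lt (n : nat) (m1 m2 : 'X_{1..n}) : bool :=
  (mdeg m1 < mdeg m2)%N ||
  ((mdeg m1 == mdeg m2) &&
   [exists i : 'I_n, (m2 i < m1 i)%N &&
      [forall j : 'I_n, (i < j)%N ==> (m1 j == m2 j)]]).

Definition leading_monomial (K : fieldType) (n : nat) (f : {mpoly K[n]})
    (m : 'X_{1..n}) : Prop :=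
  m \in msupp f /\
  forall m', m' \in msupp f -> m' != m -> degrevlex_lt m' m.

Definition generated_ideal (R : comNzRingType) (G : R -> Prop) (f : R) : Prop :=
  exists s : seq (R * R),
    (forall p, p \in s -> G p.2) /\ f = \sum_(p <- s) p.1 * p.2.

Definition initial_ideal (K : fieldType) (n : nat) (I : {pred {mpoly K[n]}}) :
    {mpoly K[n]} -> Prop :=
  generated_ideal (fun g => exists f m,
    [/\ f \in I, leading_monomial f m & g = 'X_[m]]).

(* For J a monomial ideal: its minimal generators are the monomials of J that
   are minimal for divisibility. *)
Definition minimal_generator (K : fieldType) (n : nat)
    (J : {mpoly K[n]} -> Prop) (m : 'X_{1..n}) : Prop :=
  J 'X_[m] /\ forall m', J 'X_[m'] -> (m' <= m)%MM -> m' = m.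

(* dim_K (R / I)_k = h, for R = {mpoly K[n]} with its standard grading and I
   homogeneous: h forms of degree k represent a basis. *)
Definition hilbert_value (K : fieldType) (n : nat) (I : {pred {mpoly K[n]}})
    (k h : nat) : Prop :=
  exists b : 'I_h -> {mpoly K[n]},
  [/\ forall i, b i \is k.-homog,
      forall u : 'I_h -> K, \sum_(i < h) u i *: b i \in I -> forall i, u i = 0
    & forall f, f \is k.-homog ->
        exists u : 'I_h -> K, f - \sum_(i < h) u i *: b i \in I].

Definition hilbert_polynomial (K : fieldType) (n : nat)
    (I : {pred {mpoly K[n]}}) (P : {poly rat}) : Prop :=
  exists N, forall k, (N <= k)%N ->
    exists2 h, hilbert_value I k h & P.[k%:R] = h%:R.

(* The multiplicity of R / I is e, when R / I has positive dimension: its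
   Hilbert polynomial has leading coefficient e / r!, where r is the degree of
   that polynomial. *)
Definition multiplicity (K : fieldType) (n : nat) (I : {pred {mpoly K[n]}})
    (e : nat) : Prop :=
  exists2 P, hilbert_polynomial I P
    & ((size P).-1)`!%:R * lead_coef P = e%:R.

(* idealr_closed includes properness. *)
Definition prime_ideal (R : comNzRingType) (P : {pred R}) : Prop :=
  idealr_closed P /\ prime_idealr_closed P.

(* A chain P 0 < ... < P r of primes containing I, that is, of primes of the
   quotient by I; P is irrelevant beyond r. *)
Definition prime_chain (R : comNzRingType) (I : {pred R}) (r : nat)
    (P : nat -> {pred R}) : Prop :=
  [/\ {subset I <= P 0%N},
      forall k, (k <= r)%N -> prime_ideal (P k)
    & forall k, (k < r)%N ->
        {subset P k <= P k.+1} /\ exists2 x, x \in P k.+1 & x \notin P k].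

Definition krull_dim_quotient (R : comNzRingType) (I : {pred R}) (r : nat) :
    Prop :=
  (exists P, prime_chain I r P) /\
  forall s P, prime_chain I s P -> (s <= r)%N.

(* codim (R / I) = dim R - dim (R / I), where dim {mpoly K[n]} = n. *)
Definition codimension (K : fieldType) (n : nat) (I : {pred {mpoly K[n]}})
    (k : nat) : Prop :=
  exists2 r, krull_dim_quotient I r & (k + r = n)%N.

(* Main.v *)
Require Import Defs.
From mathcomp Require Import all_boot all_order all_algebra.
From mathcomp Require Import mpoly zify.

Set Implicit Arguments.
Unset Strict Implicit.
Unset Printing Implicit Defensive.

Import GRing.Theory Num.Theory.
Local Open Scope ring_scope.

(** Let N = alpha ^ (d - 1).  There are N vectors of residues modulo alpha of
    length d with sum zero, and the degree of every element of S is a multiple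
    of alpha, so elements of S have at most N classes modulo alpha.  This
    count is the source of the term deg K[S] = N of the bound.
    On the other side, killing t_1, ..., t_d one after the other gives a chain of
    d + 1 primes above the toric ideal ([codimension_le]), so that the
    codimension is at most c.  It remains to show that a minimal generator m of
    the initial ideal has degree at most N - c + 1
    ([minimal_generator_mdeg]).

    The toric ideal is spanned by binomials, so m = x^u y^v is the larger of two
    monomials with the same image, and the other one may be taken standard,
    m' = x^u' y^v'.  Minimality makes m and m' coprime.  In the reverse
    lexicographic order every y is smaller than every x, so x^u' (and x^u when v
    is not 0) is an Apery word: no element of S is obtained from its image by
    subtracting some e_j ([standard_apery]).

    For an Apery word z, a subsum of length at least 2 is congruent modulo alpha
    neither to 0 nor to any a_i: the a_i have entries below alpha, so
    a congruence would exhibit a multiple of alpha that can be subtracted.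
    The classes of these long subsums are therefore among the N - 1 - c remaining
    ones.  Partial sums already give |z| - 1 of them ([reduced_subsums]), whence
    c + |z| <= N, which settles the case v = 0.

    When v is not 0, coprimality gives alpha v <= sum of the a_i in u', strictly
    in degree, so that deg m < |u| + |u'|.  Thus c + 2|z| <= N + 2 for Apery words
    suffices ([apery_mdeg2]).  If z has two distinct letters, there are at least
    2|z| - 3 long subsums: a removed letter takes with it the full sum and the
    sum without another letter ([reduced_subsums2]).  If z is a power of one
    letter, then |z| < alpha, and enough classes are missed by 0 and the a_i
    because their reduced representatives have degree 2 alpha; this is where
    d > alpha is used, to have room for 4 coordinates when alpha > 2. *)

(** * Subsums of a word in an abelian group *)

Lemma mdegB_lep n (z1 z : 'X_{1..n}) : (z1 <= z)%MM -> mdeg (z - z1)%MM = (mdeg z - mdeg z1)%N.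
Proof. by move=> le1; rewrite -{2}(submK le1) mdegD addnK. Qed.

Lemma exists_letter n (z : 'X_{1..n}) : (0 < mdeg z)%N -> exists i, z i != 0%N.
Proof.
move=> z_gt0; apply/existsP; apply: contraLR z_gt0 => /existsPn z0.
by rewrite -eqn0Ngt mdegE big1 // => i _; apply/eqP/negPn/z0.
Qed.

Section Subsums.

Variables (n : nat) (V : zmodType) (g : 'I_n -> V).
Implicit Types (z : 'X_{1..n}) (s : seq V).

Definition multisum z : V := \sum_i g i *+ z i.

Lemma multisumD z1 z2 : multisum (z1 + z2)%MM = multisum z1 + multisum z2.
Proof.
by rewrite -big_split; apply: eq_bigr => i _; rewrite mnmDE mulrnDr.
Qed.

Lemma multisum1 i : multisum U_(i) = g i.
Proof.
rewrite /multisum (bigD1 i) //= mnm1E eqxx big1 ?addr0 // => j /negPf ji.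
by rewrite mnm1E eq_sym ji.
Qed.

Lemma multisumB z1 z : (z1 <= z)%MM ->
  multisum (z - z1)%MM = multisum z - multisum z1.
Proof. by move=> le_z; rewrite -{2}(submK le_z) multisumD addrK. Qed.

(** Zero-sum freeness, strengthened so that no subword can be traded for a
    single letter; with zero-sum freeness alone, a word such as g^p (2g)^q in
    a large cyclic group loses only one subsum when one of p > 1 letters g is
    removed. *)
Definition reduced z := forall z1, (z1 <= z)%MM ->
  (multisum z1 = 0 -> z1 = 0%MM) /\ (forall i, multisum z1 = g i -> z1 = U_(i)%MM).

Lemma reducedW z1 z : (z1 <= z)%MM -> reduced z -> reduced z1.
Proof. by move=> le1 red_z z2 le2; apply/red_z/(lepm_trans le2). Qed.

Definition long_subsum z r :=
  exists z1, [/\ (z1 <= z)%MM, (1 < mdeg z1)%N & r = multisum z1].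

Lemma long_subsumW z1 z r : (z1 <= z)%MM -> long_subsum z1 r -> long_subsum z r.
Proof.
by move=> le1 [z2 [le2 deg2 ->]]; exists z2; split=> //; apply: lepm_trans le1.
Qed.

(** The sum of z is lost when a letter is removed: otherwise the complement of
    the subword that still attains it would be a nonempty zero-sum word. *)
Lemma multisum_fresh z i z1 : reduced z -> z i != 0%N ->
  (z1 <= z - U_(i))%MM -> multisum z1 != multisum z.
Proof.
move=> red_z zi le1; apply/eqP => eq1.
have le_z1 : (z1 <= z)%MM by apply: lepm_trans le1 (lem_subr _ _).
have [+ _] := red_z (z - z1)%MM (lem_subr _ _).
rewrite multisumB // eq1 subrr => /(_ erefl) /mnmP /(_ i).
move: le1 => /mnm_lepP /(_ i); rewrite !mnmBE mnm1E eqxx mnm0E; lia.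
Qed.

(** Partial sums: each letter contributes at least one new value, the full sum. *)
Lemma reduced_subsums z : reduced z -> (0 < mdeg z)%N ->
  exists s, [/\ uniq s, size s = (mdeg z).-1
    & forall r, r \in s -> long_subsum z r].
Proof.
have [p] := ubnP (mdeg z); elim: p z => // p IHp z lt_zp red_z z_gt0.
have [i zi] := exists_letter z_gt0.
have lez : (z - U_(i) <= z)%MM by apply: lem_subr.
have degz : mdeg (z - U_(i))%MM = (mdeg z).-1.
  by rewrite mdegB_lep ?lep1mP // mdeg1 subn1.
have [z1|z_gt1] := leqP (mdeg z) 1.
  by exists [::]; split=> //=; lia.
have [|||s [uniq_s size_s sub_s]] := IHp (z - U_(i))%MM; try lia.
  exact: reducedW red_z.
exists (multisum z :: s); split.
- rewrite /= uniq_s andbT; apply/negP => /sub_s [z1 [le1 _ eq1]].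
  by have := multisum_fresh red_z zi le1; rewrite eq1 eqxx.
- by rewrite /= size_s degz; lia.
- move=> r; rewrite inE => /predU1P [->|/sub_s]; last exact: long_subsumW.
  by exists z; rewrite lepm_refl.
Qed.

(** A second value is lost along with the letter i: if a subword of z avoiding
    one occurrence of i had the sum of z minus h, its complement would contain i
    and have the sum of the letter h, hence be that letter. *)
Lemma multisum_drop_fresh z i h z1 : reduced z -> i != h -> z i != 0%N ->
  z h != 0%N -> (z1 <= z - U_(i))%MM -> multisum z1 != multisum (z - U_(h))%MM.
Proof.
move=> red_z ne_ih zi zh le1; apply/eqP => eq1.
have le_z1 : (z1 <= z)%MM by apply: lepm_trans le1 (lem_subr _ _).
have [_ /(_ h)] := red_z (z - z1)%MM (lem_subr _ _).
rewrite multisumB // eq1 multisumB ?lep1mP // multisum1 opprB addrC subrK.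
move=> /(_ erefl) /mnmP /(_ i); move: le1 => /mnm_lepP /(_ i).
rewrite !mnmBE !mnm1E eqxx (eq_sym h) (negPf ne_ih); lia.
Qed.

(** As long as two distinct letters remain, each further letter contributes two
    new values; the word made of these two letters alone contributes one. *)
Lemma reduced_subsums2 z i h : reduced z -> i != h -> z i != 0%N ->
  z h != 0%N ->
  exists s, [/\ uniq s, size s = (2 * mdeg z - 3)%N
    & forall r, r \in s -> long_subsum z r].
Proof.
have [p] := ubnP (mdeg z).
elim: p z i h => // p IHp z i h lt_zp red_z ne_ih zi zh.
have le_ih : (U_(i) + U_(h) <= z)%MM.
  apply/mnm_lepP => k; rewrite mnmDE !mnm1E.
  case: eqP => [<-|_]; first by rewrite eq_sym (negPf ne_ih); lia.
  by case: eqP => [<-|]; lia.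
have deg_ih : mdeg (U_(i) + U_(h) : 'X_{1..n})%MM = 2%N by rewrite mdegD !mdeg1.
have z_gt1 : (1 < mdeg z)%N.
  by rewrite -(submK le_ih) mdegD deg_ih; lia.
have [z2|z_gt2] := leqP (mdeg z) 2.
  exists [:: multisum z]; split=> //=; first by lia.
  by move=> r; rewrite inE => /eqP ->; exists z; rewrite lepm_refl.
have [|k zk] := @exists_letter _ (z - (U_(i) + U_(h)))%MM.
  by rewrite mdegB_lep // deg_ih; lia.
(* A third letter k to remove; it differs from i or from h. *)
wlog ne_kh : i h ne_ih zi zh le_ih deg_ih zk / k != h.
  move=> wl; have [eq_kh|] := eqVneq k h; last exact: (wl i h).
  have ne_hi : h != i by rewrite eq_sym.
  by apply: (wl h i); rewrite ?(addmC U_(h)%MM) // eq_kh.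
move: zk; rewrite mnmBE mnmDE !mnm1E (eq_sym h) (negPf ne_kh) addn0 => zk.
have zk0 : z k != 0%N by lia.
have degz j : z j != 0%N -> mdeg (z - U_(j))%MM = (mdeg z).-1.
  by move=> zj; rewrite mdegB_lep ?lep1mP // mdeg1 subn1.
have [|||||s [uniq_s size_s sub_s]] := IHp (z - U_(k))%MM i h.
- by rewrite degz; lia.
- by apply: reducedW red_z; apply: lem_subr.
- exact: ne_ih.
- rewrite mnmBE mnm1E; move: zk; rewrite (eq_sym i).
  by case: (eqVneq k i) => [->|_] // _; rewrite subn0.
- by rewrite mnmBE mnm1E (negPf ne_kh); lia.
exists [:: multisum z, multisum (z - U_(h))%MM & s]; split.
- rewrite /= uniq_s inE negb_or andbT -andbA; apply/and3P; split.
  + by rewrite eq_sym (multisum_fresh red_z zh) ?lepm_refl.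
  + apply/negP => /sub_s [z1 [le1 _ eq1]].
    by have := multisum_fresh red_z zk0 le1; rewrite eq1 eqxx.
  + apply/negP => /sub_s [z1 [le1 _ eq1]].
    by have := multisum_drop_fresh red_z ne_kh zk0 zh le1; rewrite eq1 eqxx.
- by rewrite /= size_s degz //; lia.
- move=> r; rewrite !inE => /or3P [/eqP ->|/eqP ->|/sub_s].
  + by exists z; rewrite lepm_refl.
  + by exists (z - U_(h))%MM; rewrite lem_subr degz //; split=> //; lia.
  + by apply: long_subsumW; apply: lem_subr.
Qed.

End Subsums.

(** * Classes modulo alpha *)

Section Residues.

Variables (d alpha : nat).
Hypothesis alpha_gt1 : (1 < alpha)%N.
Implicit Types (w : 'X_{1..d}).

Definition residue w : 'rV['Z_alpha]_d := \row_j (w j)%:R.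

Lemma residue_eqP w1 w2 : residue w1 = residue w2 ->
  forall j, w1 j = w2 j %[mod alpha].
Proof.
move=> /rowP eqw j; have /(congr1 val) := eqw j.
by rewrite !mxE /= !val_Zp_nat.
Qed.

(** A vector with entries below alpha is the least nonnegative one in its
    class. *)
Lemma residue_eq w1 w2 : (forall j, (w1 j < alpha)%N) ->
  residue w1 = residue w2 -> exists v, w2 = (w1 + v *+ alpha)%MM.
Proof.
move=> w1_lt /residue_eqP eqw; exists [multinom w2 j %/ alpha | j < d]%N.
apply/mnmP => j; rewrite mnmDE mulmnE mnmE.
by rewrite -{1}(modn_small (w1_lt j)) eqw addnC -divn_eq.
Qed.

Lemma residue0 : residue 0%MM = 0.
Proof. by apply/rowP => j; rewrite !mxE mnmE. Qed.

Lemma residueMalpha w : residue (w *+ alpha)%MM = 0.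
Proof. by apply/rowP => j; rewrite !mxE mulmnE natrM pchar_Zp // mulr0. Qed.

Lemma residue_hyperplane w : (alpha %| mdeg w)%N -> \sum_j residue w 0 j = 0.
Proof.
move=> dvd_w; rewrite (eq_bigr (fun j => (w j)%:R)) => [|j _]; last by rewrite mxE.
by rewrite -natr_sum -mdegE -(divnK dvd_w) natrM pchar_Zp // mulr0.
Qed.

End Residues.

Lemma size_hyperplane (R : finComNzRingType) d (s : seq 'rV[R]_d) : uniq s ->
  (forall r, r \in s -> \sum_j r 0 j = 0) -> (0 < d)%N -> (size s <= #|R| ^ d.-1)%N.
Proof.
case: d s => // d s uniq_s sum_s _.
have inj_s : {in s &, injective (fun r : 'rV[R]_d.+1 => \row_(j < d) r 0 (lift ord0 j))}.
  move=> r1 r2 /sum_s sum1 /sum_s sum2 /rowP eq12.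
  have eq_lift j : r1 0 (lift ord0 j) = r2 0 (lift ord0 j).
    by have := eq12 j; rewrite !mxE.
  apply/rowP => j; case: (unliftP ord0 j) => [k ->|->]; first exact: eq_lift.
  apply: (addIr (\sum_(j < d) r1 0 (lift ord0 j))).
  by rewrite -big_ord_recl sum1 (eq_bigr _ (fun j _ => eq_lift j)) -big_ord_recl.
rewrite -[d.+1.-1]mul1n -card_mx.
rewrite -(size_map (fun r : 'rV[R]_d.+1 => \row_(j < d) r 0 (lift ord0 j))).
move: uniq_s; rewrite -(map_inj_in_uniq inj_s) => /card_uniqP <-.
exact: max_card.
Qed.

Section HeightTwo.

Variables (d alpha : nat).

(** The rows (alpha - 1, i + 2, alpha - 1 - i, 0) and
    (alpha - 1, i + 2, 0, alpha - 1 - i), for i < alpha - 2, continued by zeros: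
    their entries are below alpha but their degree is 2 alpha, so their classes
    contain no vector of nonnegative entries and degree alpha. *)
Definition height_two (x : 'I_(alpha - 2) * bool) : 'X_{1..d} :=
  [multinom nth 0%N [:: alpha.-1; x.1.+2; if x.2 then 0%N else alpha.-1 - x.1;
                        if x.2 then alpha.-1 - x.1 else 0%N]%N j | j < d].

Lemma height_two_lt x j : (height_two x j < alpha)%N.
Proof.
rewrite mnmE; case: x => i b /=; have := ltn_ord i.
by case: (val j) => [|[|[|[|[|?]]]]]; case: b => /=; lia.
Qed.

Lemma mdeg_height_two x : (3 < d)%N -> mdeg (height_two x) = (2 * alpha)%N.
Proof.
rewrite /height_two; case: d => [|[|[|[|e]]]] // _; case: x => i b.
rewrite mdegE (eq_bigr _ (fun j _ => mnmE _ j)) !big_ord_recl big1 => [|j _] /=.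
  by have := ltn_ord i; case: b => /=; lia.
by rewrite nth_nil.
Qed.

Lemma height_two_inj : (1 < alpha)%N -> (3 < d)%N ->
  injective (fun x => residue alpha (height_two x)).
Proof.
move=> alpha_gt1 d_gt3 x y /(residue_eqP alpha_gt1) eq_xy.
have {eq_xy} eq_xy j : height_two x j = height_two y j.
  by move: (eq_xy j); rewrite !modn_small ?height_two_lt.
have := eq_xy (Ordinal (ltnW (ltnW d_gt3))).
have := eq_xy (Ordinal (ltnW d_gt3)).
rewrite !mnmE /=; case: x y {eq_xy} => [i b] [i' b'] /= eq2 [eq1].
have /val_inj eq_i : val i = val i' by [].
subst i'; congr (_, _); move: eq2; have := ltn_ord i.
by case: b b' => [] [] //=; lia.
Qed.

End HeightTwo.

(** * Apery words and the number of classes *)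

Section Counting.

Variables (c d alpha : nat) (a : 'I_c -> 'X_{1..d}).
Hypothesis alpha_gt1 : (1 < alpha)%N.
Hypothesis d_gt0 : (0 < d)%N.
Hypothesis a_deg : forall i, mdeg (a i) = alpha.
Hypothesis a_inj : injective a.
Hypothesis a_lt : forall i j, (a i j < alpha)%N.

Definition weight (z : 'X_{1..c}) : 'X_{1..d} := (\sum_i a i *+ z i)%MM.

Lemma weightE z j : weight z j = (\sum_i a i j * z i)%N.
Proof. by rewrite mnm_sumE; apply: eq_bigr => i _; rewrite mulmnE. Qed.

Lemma weightD z1 z2 : weight (z1 + z2)%MM = (weight z1 + weight z2)%MM.
Proof.
apply/mnmP => j; rewrite mnmDE !weightE -big_split.
by apply: eq_bigr => i _; rewrite mnmDE mulnDr.
Qed.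

Lemma weight1 i : weight U_(i)%MM = a i.
Proof.
apply/mnmP => j; rewrite weightE (bigD1 i) //= mnm1E eqxx muln1 big1 ?addn0 //.
by move=> k /negPf ki; rewrite mnm1E eq_sym ki muln0.
Qed.

Lemma weight0 : weight 0%MM = 0%MM.
Proof.
apply/mnmP => j; rewrite weightE big1 ?mnmE // => i _.
by rewrite mnmE muln0.
Qed.

Lemma mdeg_weight z : mdeg (weight z) = (alpha * mdeg z)%N.
Proof.
rewrite mdeg_sum [mdeg z]mdegE big_distrr; apply: eq_bigr => i _ /=.
by rewrite mdegMn a_deg.
Qed.

Lemma residue_weight z :
  residue alpha (weight z) = multisum (fun i => residue alpha (a i)) z.
Proof.
apply/rowP => j; rewrite mxE weightE natr_sum summxE; apply: eq_bigr => i _.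
by rewrite mulmxnE mxE natrM mulr_natr.
Qed.

(** The image of z lies in the Apery set of S with respect to e_1, ..., e_d:
    subtracting a nonzero combination of the e_j leaves the semigroup. *)
Definition apery z :=
  forall u v, weight z = (weight u + v *+ alpha)%MM -> v = 0%MM.

Lemma aperyW z1 z : (z1 <= z)%MM -> apery z -> apery z1.
Proof.
move=> le_z ap_z u v eq1; apply: (ap_z (u + (z - z1))%MM).
by rewrite -{1}(submK le_z) !weightD eq1 addmC -!addmA [(v *+ _ + _)%MM]addmC.
Qed.

Lemma apery_residue0 z : apery z -> residue alpha (weight z) = 0 -> z = 0%MM.
Proof.
move=> ap_z; rewrite -(residue0 d alpha).
move=> /esym /(residue_eq alpha_gt1) [|v eq_v].
  by move=> j; rewrite mnmE ltnW.
have v0 : v = 0%MM by apply: (ap_z 0%MM); rewrite weight0.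
have := mdeg_weight z; rewrite eq_v v0 add0m mdegMn mdeg0 mul0n.
by move=> deg_z; apply/eqP; rewrite -mdeg_eq0; nia.
Qed.

Lemma apery_residue_gen z i : apery z ->
  residue alpha (weight z) = residue alpha (a i) -> z = U_(i)%MM.
Proof.
move=> ap_z /esym /(residue_eq alpha_gt1 (a_lt i)) [v eq_v].
have v0 : v = 0%MM by apply: (ap_z U_(i)%MM); rewrite weight1.
have eq_z : weight z = a i.
  by rewrite eq_v v0; apply/mnmP => j; rewrite mnmDE mulmnE mnmE addn0.
have /eqP/mdeg1P [k /eqP zk] : mdeg z = 1%N.
  by have := mdeg_weight z; rewrite eq_z a_deg; nia.
by move: eq_z; rewrite zk weight1 => /a_inj ->.
Qed.

Lemma apery_reduced z : apery z ->
  reduced (fun i => residue alpha (a i)) z.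
Proof.
move=> ap_z z1 le1; have ap_z1 := aperyW le1 ap_z.
by split=> [|i]; rewrite -residue_weight => *;
  [apply: apery_residue0 | apply: apery_residue_gen].
Qed.

Lemma residue_gen_inj : injective (fun i => residue alpha (a i)).
Proof.
move=> i k /(residue_eqP alpha_gt1) eq_ik; apply: a_inj; apply/mnmP => j.
by have := eq_ik j; rewrite !modn_small.
Qed.

Lemma residue_gen_neq0 i : residue alpha (a i) != 0.
Proof.
apply/eqP; rewrite -(residue0 d alpha) => /(residue_eqP alpha_gt1) eq_i0.
have ai0 : a i = 0%MM.
  by apply/mnmP => j; have := eq_i0 j; rewrite !modn_small // mnmE; lia.
by have := a_deg i; rewrite ai0 mdeg0; lia.
Qed.

(** The classes of 0 and of a_1, ..., a_c are c + 1 further elements of a set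
    of size alpha ^ (d - 1). *)
Lemma size_residues (s : seq 'rV['Z_alpha]_d) : uniq s ->
  (forall r, r \in s ->
    [/\ \sum_j r 0 j = 0, r != 0 & forall i, r != residue alpha (a i)]) ->
  (c + size s < alpha ^ d.-1)%N.
Proof.
move=> uniq_s sP.
have cardZ : #|'Z_alpha| = alpha by rewrite card_ord Zp_cast.
pose t := 0 :: [seq residue alpha (a i) | i <- enum 'I_c] ++ s.
have -> : (c + size s).+1 = size t by rewrite /= size_cat size_map size_enum_ord.
rewrite -{2}cardZ; apply: size_hyperplane => //.
- rewrite /= cat_uniq uniq_s andbT (map_inj_uniq residue_gen_inj) enum_uniq /=.
  rewrite mem_cat negb_or -andbA; apply/and3P; split.
  + apply/mapP => -[i _ /eqP]; rewrite eq_sym; apply/negP.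
    exact: residue_gen_neq0.
  + by apply/negP => /sP [_]; rewrite eqxx.
  + apply/hasP => -[r /sP [_ _ neq_r] /mapP [i _ eq_r]].
    by have := neq_r i; rewrite eq_r eqxx.
- move=> r; rewrite inE mem_cat => /or3P [/eqP ->|/mapP [i _ ->]|/sP []//].
    by rewrite big1 // => j _; rewrite mxE.
  by apply: residue_hyperplane; rewrite ?a_deg.
Qed.

Lemma long_subsum_new z r : apery z ->
  long_subsum (fun i => residue alpha (a i)) z r ->
  [/\ \sum_j r 0 j = 0, r != 0 & forall i, r != residue alpha (a i)].
Proof.
move=> ap_z [z1 [le1 deg1 ->]]; have ap_z1 := aperyW le1 ap_z.
rewrite -residue_weight; split.
- by apply: residue_hyperplane; rewrite // mdeg_weight dvdn_mulr.
- by apply: contraL deg1 => /eqP /(apery_residue0 ap_z1) ->; rewrite mdeg0.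
- move=> i; apply: contraL deg1 => /eqP /(apery_residue_gen ap_z1) ->.
  by rewrite mdeg1.
Qed.

Lemma size_gens_lt : (c < alpha ^ d.-1)%N.
Proof. by have := @size_residues [::] erefl; rewrite addn0; apply. Qed.

Lemma apery_mdeg z : apery z -> (c + mdeg z <= alpha ^ d.-1)%N.
Proof.
move=> ap_z; have [->|z_gt0] := posnP (mdeg z).
  by rewrite addn0 ltnW // size_gens_lt.
have [s [uniq_s size_s sub_s]] := reduced_subsums (apery_reduced ap_z) z_gt0.
have := size_residues uniq_s (fun r rs => long_subsum_new ap_z (sub_s r rs)).
by rewrite size_s; lia.
Qed.

(** The sum of alpha copies of a_i is alpha times a vector. *)
Lemma apery_power i p : apery (U_(i) *+ p)%MM -> (p < alpha)%N.
Proof.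
move=> ap; rewrite ltnNge; apply/negP => le_p.
have /(apery_residue0) : apery (U_(i) *+ alpha)%MM.
  by apply: aperyW ap; apply/mnm_lepP => j; rewrite !mulmnE leq_mul2l le_p orbT.
have -> : weight (U_(i) *+ alpha)%MM = (a i *+ alpha)%MM.
  apply/mnmP => j; rewrite weightE mulmnE (bigD1 i) //= big1 => [|k /negPf ki].
    by rewrite addn0 mulmnE mnm1E eqxx mul1n.
  by rewrite mulmnE mnm1E eq_sym ki mul0n muln0.
rewrite residueMalpha // => /(_ erefl) /mnmP /(_ i).
by rewrite mulmnE mnm1E eqxx mnmE; lia.
Qed.

Lemma height_two_new (x : 'I_(alpha - 2) * bool) : (3 < d)%N ->
  let r := residue alpha (height_two d x) in
  [/\ \sum_j r 0 j = 0, r != 0 & forall i, r != residue alpha (a i)].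
Proof.
move=> d_gt3 r; have deg_x := mdeg_height_two x d_gt3.
have r_neq (w : 'X_{1..d}) : (forall j, w j < alpha)%N ->
    mdeg w != (2 * alpha)%N ->
    r != residue alpha w.
  move=> w_lt; rewrite -deg_x; apply: contraNneq.
  move=> /(residue_eqP alpha_gt1) eq_w; apply/eqP; congr mdeg; apply/mnmP => j.
  by have := eq_w j; rewrite !modn_small ?height_two_lt.
split.
- by apply: residue_hyperplane; rewrite // deg_x dvdn_mull.
- by rewrite -(residue0 d alpha) r_neq ?mdeg0 //; [move=> j; rewrite mnmE; lia|lia].
- by move=> i; rewrite r_neq ?a_deg //; lia.
Qed.

(** The word has either two distinct letters, with many long subsums, or only
    one, and then length below alpha; the missed classes are provided by
    [height_two] in the second case. *)
Lemma apery_mdeg2 z : (alpha < d)%N -> apery z ->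
  (c + 2 * mdeg z <= alpha ^ d.-1 + 2)%N.
Proof.
move=> alpha_lt ap_z; have c_lt := size_gens_lt.
have [z0|z_gt0] := posnP (mdeg z); first by lia.
have [i zi] := exists_letter z_gt0.
have [/existsP [h /andP [ne_ih zh]]|] := boolP [exists h, (i != h) && (z h != 0%N)].
  have [s [uniq_s size_s sub_s]] := reduced_subsums2 (apery_reduced ap_z) ne_ih zi zh.
  have := size_residues uniq_s (fun r rs => long_subsum_new ap_z (sub_s r rs)).
  by rewrite size_s; lia.
move=> /existsPn z_supp.
have z_pow : z = (U_(i) *+ z i)%MM.
  apply/mnmP => h; rewrite mulmnE mnm1E; have := z_supp h.
  by case: eqP => [<-|_ /negPn/eqP ->]; rewrite ?mul1n.
have deg_z : mdeg z = z i by rewrite z_pow mdegMn mdeg1 mul1n -z_pow.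
have z_lt : (z i < alpha)%N by apply: (@apery_power i); rewrite -z_pow.
have [alpha2|alpha_gt2] := leqP alpha 2; first by lia.
have d_gt3 : (3 < d)%N by lia.
have := @size_residues [seq residue alpha (height_two d x) | x : 'I_(alpha - 2) * bool].
rewrite size_map -cardE card_prod card_ord card_bool => size_tall.
have {}size_tall : (c + (alpha - 2) * 2 < alpha ^ d.-1)%N.
  apply: size_tall; last by move=> r /mapP [x _ ->]; apply: height_two_new.
  by rewrite (map_inj_uniq (height_two_inj alpha_gt1 d_gt3)) enum_uniq.
by lia.
Qed.

End Counting.

(** * The reverse lexicographic order and the initial ideal *)

Section DegRevLex.

Variable n : nat.
Implicit Types m : 'X_{1..n}.

Lemma degrevlexP m1 m2 : mdeg m1 = mdeg m2 ->
  reflect (exists2 i, (m2 i < m1 i)%N & forall j : 'I_n, (i < j)%N -> m1 j = m2 j)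
          (degrevlex_lt m1 m2).
Proof.
move=> eq_deg; rewrite /degrevlex_lt eq_deg ltnn eqxx /=.
apply: (iffP existsP) => [[i /andP [lt_i /forallP eq_j]]|[i lt_i eq_j]].
  by exists i => // j /(implyP (eq_j j)) /eqP.
by exists i; rewrite lt_i; apply/forallP => j; apply/implyP => /eq_j ->.
Qed.

Lemma degrevlex_irr m : ~~ degrevlex_lt m m.
Proof. by apply/degrevlexP => // -[i]; rewrite ltnn. Qed.

Lemma degrevlex_trans m2 m1 m3 : mdeg m1 = mdeg m2 -> mdeg m2 = mdeg m3 ->
  degrevlex_lt m1 m2 -> degrevlex_lt m2 m3 -> degrevlex_lt m1 m3.
Proof.
move=> deg12 deg23 /(degrevlexP deg12) [i lt_i eq_i].
move=> /(degrevlexP deg23) [k lt_k eq_k]; apply/degrevlexP; first by rewrite deg12.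
case: (ltngtP i k) => [lt_ik|lt_ki|/val_inj eq_ik].
- exists k; first by rewrite eq_i.
  by move=> j lt_kj; rewrite eq_i ?eq_k //; apply: ltn_trans lt_kj.
- exists i; first by rewrite -eq_k.
  by move=> j lt_ij; rewrite eq_i ?eq_k //; apply: ltn_trans lt_ij.
- exists k; first by rewrite -eq_ik in lt_k *; apply: ltn_trans lt_i.
  by move=> j lt_j; rewrite eq_i ?eq_k ?eq_ik.
Qed.

Lemma degrevlex_add2r m m1 m2 :
  degrevlex_lt (m1 + m)%MM (m2 + m)%MM = degrevlex_lt m1 m2.
Proof.
rewrite /degrevlex_lt !mdegD ltn_add2r eqn_add2r; congr (_ || _ && _).
apply: eq_existsb => i; rewrite !mnmDE ltn_add2r; congr (_ && _).
by apply: eq_forallb => j; rewrite !mnmDE eqn_add2r.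
Qed.

End DegRevLex.

Section ToricFibres.

Variables (K : fieldType) (c d alpha : nat) (a : 'I_c -> 'X_{1..d}).
Hypothesis alpha_gt0 : (0 < alpha)%N.
Hypothesis a_deg : forall i, mdeg (a i) = alpha.

Implicit Types (m : 'X_{1..(c + d)}) (u : 'X_{1..c}) (v : 'X_{1..d}).

Local Notation gens := (generators alpha a).
Local Notation I := (toric_ideal K alpha a).

(** The exponent of x^u y^v. *)
Definition joinm u v : 'X_{1..(c + d)} :=
  [multinom match split k with inl i => u i | inr j => v j end | k < c + d].
Definition xpart m : 'X_{1..c} := [multinom m (lshift d i) | i < c].
Definition ypart m : 'X_{1..d} := [multinom m (rshift c j) | j < d].

Lemma joinmEl u v i : joinm u v (lshift d i) = u i.
Proof. by rewrite mnmE (unsplitK (inl i)). Qed.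

Lemma joinmEr u v j : joinm u v (rshift c j) = v j.
Proof. by rewrite mnmE (unsplitK (inr j)). Qed.

Lemma xpart_joinm u v : xpart (joinm u v) = u.
Proof. by apply/mnmP => i; rewrite mnmE joinmEl. Qed.

Lemma joinmK m : joinm (xpart m) (ypart m) = m.
Proof.
apply/mnmP => k; rewrite -(splitK k); case: (split k) => i /=.
  by rewrite joinmEl mnmE.
by rewrite joinmEr mnmE.
Qed.

Lemma mdeg_joinm u v : mdeg (joinm u v) = (mdeg u + mdeg v)%N.
Proof.
rewrite !mdegE big_split_ord /=.
by congr addn; apply: eq_bigr => i _; rewrite ?joinmEl ?joinmEr.
Qed.

Lemma mdeg_generators k : mdeg (gens k) = alpha.
Proof.
by rewrite /generators; case: split => i //; rewrite mdegMn mdeg1 mul1n.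
Qed.

Lemma weight_joinm u v : weight gens (joinm u v) = (weight a u + v *+ alpha)%MM.
Proof.
apply/mnmP => j; rewrite mnmDE !weightE big_split_ord /=; congr addn.
  apply: eq_bigr => i _; rewrite joinmEl.
  by rewrite /generators (unsplitK (inl i)).
rewrite mulmnE (bigD1 j) //= big1 => [|k /negPf kj].
  by rewrite joinmEr /generators (unsplitK (inr j)) mulmnE mnm1E eqxx mul1n addn0 mulnC.
by rewrite /generators (unsplitK (inr k)) mulmnE mnm1E kj.
Qed.

Lemma weight_mdeg m1 m2 : weight gens m1 = weight gens m2 -> mdeg m1 = mdeg m2.
Proof.
move=> /(congr1 (@mdeg d)); rewrite !(mdeg_weight mdeg_generators) => /eqP.
by rewrite eqn_pmul2l // => /eqP.
Qed.

(** The standard monomials of the toric ideal: as the ideal is spanned by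
    binomials, a monomial lies outside the initial ideal exactly when it is the
    smallest with its image. *)
Definition standard m :=
  forall m', weight gens m' = weight gens m -> ~~ degrevlex_lt m' m.

(** If e_j could be subtracted from the image of the x-part, then the
    monomial could be rewritten with more y's, which makes it smaller. *)
Lemma standard_apery m : standard m -> apery alpha a (xpart m).
Proof.
move=> std_m u v eq_w; apply/eqP; rewrite -mdeg_eq0 -leqn0 leqNgt.
apply/negP => /exists_letter [j0 vj0].
(* The order is decided at the last variable whose exponent changes. *)
have [j vj j_max] := @arg_maxnP _ j0 (fun j => v j != 0%N) val vj0.
have eq_wm : weight gens (joinm u (v + ypart m)) = weight gens m.
  rewrite -{2}(joinmK m) !weight_joinm eq_w -addmA; congr (_ + _)%MM.
  by apply/mnmP => k; rewrite !(mnmDE, mulmnE) mulnDl.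
have /negP := std_m _ eq_wm; apply.
apply/degrevlexP; first exact: weight_mdeg.
exists (rshift c j); first by rewrite joinmEr mnmDE mnmE; lia.
move=> k; rewrite -(splitK k); case: (split k) => i /=.
  by have := ltn_ord i; lia.
rewrite ltn_add2l joinmEr mnmDE mnmE => lt_ji.
have [vi|/negPn/eqP ->] := boolP (v i != 0%N); last by rewrite add0n.
by have := j_max i vi; rewrite /= leqNgt lt_ji.
Qed.

(** Monomials with a given image have a given degree, hence are finitely many;
    the one with the fewest smaller ones is the smallest. *)
Lemma exists_standard m m1 : weight gens m1 = weight gens m ->
    degrevlex_lt m1 m ->
  exists m', [/\ weight gens m' = weight gens m, degrevlex_lt m' m & standard m'].
Proof.
move=> eq_m1 lt_m1; pose T := 'X_{1..(c + d) < (mdeg m).+1}.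
pose P (x : T) := (weight gens x == weight gens m) && degrevlex_lt x m.
have bd x : weight gens x = weight gens m -> (mdeg x < (mdeg m).+1)%N.
  by move/weight_mdeg ->.
have P1 : P (BMultinom (bd _ eq_m1)) by rewrite /P /= eq_m1 eqxx.
pose rank (x : T) := #|[pred y : T | P y & degrevlex_lt y x]|.
have [x /andP [/eqP eq_x lt_x] x_min] := arg_minnP rank P1.
exists x; split=> // y eq_y; apply/negP => lt_y.
have eq_ym : weight gens y = weight gens m by rewrite eq_y.
pose y' : T := BMultinom (bd _ eq_ym).
have Py : P y'.
  rewrite /P /= eq_ym eqxx /=.
  by apply: degrevlex_trans lt_y lt_x; apply: weight_mdeg; rewrite // eq_x.
have := x_min y' Py; rewrite leqNgt => /negP; apply; apply/proper_card.
apply/properP; split.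
  apply/subsetP => z; rewrite !inE => /andP [Pz lt_zy]; rewrite Pz /=.
  have /andP [/eqP eq_z _] := Pz.
  by apply: degrevlex_trans lt_zy lt_y; apply: weight_mdeg; rewrite /= ?eq_z ?eq_ym.
exists y'; first by rewrite !inE Py lt_y.
by rewrite !inE negb_and degrevlex_irr orbT.
Qed.

Lemma toric_mapX m : toric_map alpha a ('X_[m] : {mpoly K[c + d]}) =
  'X_[weight gens m].
Proof.
rewrite /toric_map comp_mpolyX /weight.
by rewrite -mprodXnE; apply: eq_bigr => k _; rewrite tnth_mktuple.
Qed.

Lemma toric_mapE (f : {mpoly K[c + d]}) :
  toric_map alpha a f = \sum_(m <- msupp f) f@_m *: 'X_[weight gens m].
Proof.
rewrite /toric_map comp_mpolyEX; apply: eq_bigr => m _.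
by rewrite -toric_mapX.
Qed.

(** The terms of f with the same image as m must cancel. *)
Lemma toric_ideal_fibre (f : {mpoly K[c + d]}) m : f \in I -> m \in msupp f ->
  exists m', [/\ m' \in msupp f, m' != m & weight gens m' = weight gens m].
Proof.
move=> /eqP f0 m_f.
have [/hasP [m' m'_f /andP [ne_m /eqP eq_m]]|/hasPn no_m] :=
    boolP (has (fun m' => (m' != m) && (weight gens m' == weight gens m)) (msupp f)).
  by exists m'.
have := congr1 (mcoeff (weight gens m)) f0.
rewrite toric_mapE raddf_sum /= mcoeff0 (bigD1_seq m) //=.
rewrite mcoeffZ mcoeffX eqxx mulr1 big_seq_cond big1 ?addr0 => [fm0|m'].
  by move: m_f; rewrite mcoeff_msupp fm0 eqxx.
move=> /andP [/no_m + ne_m]; rewrite ne_m /= mcoeffZ mcoeffX => /negPf ->.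
by rewrite mulr0.
Qed.

Lemma binomial_initial m m' : weight gens m' = weight gens m ->
  degrevlex_lt m' m -> initial_ideal I 'X_[m].
Proof.
move=> eq_m lt_m; exists [:: (1, 'X_[m])]; split; last by rewrite big_seq1 mul1r.
have ne_m : (m' == m) = false.
  by apply/negP => /eqP eq_mm; rewrite eq_mm (negPf (degrevlex_irr _)) in lt_m.
move=> p; rewrite inE => /eqP -> /=; exists ('X_[m] - 'X_[m']), m; split=> //.
  by rewrite inE /toric_map comp_mpolyB -!/(toric_map alpha a _) !toric_mapX eq_m subrr.
split; first by rewrite mcoeff_msupp mcoeffB !mcoeffX eqxx ne_m subr0 oner_eq0.
move=> m2; rewrite mcoeff_msupp mcoeffB !mcoeffX => + ne_m2.
by rewrite [m == m2]eq_sym (negPf ne_m2); case: (m' =P m2) => [<-|]; rewrite ?subrr ?eqxx.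
Qed.

Lemma initial_ideal_fibre m : initial_ideal I 'X_[m] ->
  exists m0 m', [/\ (m0 <= m)%MM, weight gens m' = weight gens m0
                  & degrevlex_lt m' m0].
Proof.
case=> s [sP eq_m].
have [/hasP [p /sP [f [m0 [f_I [m0_f lead_f] ->]]] pm]|/hasPn s0] :=
    boolP (has (fun p => m \in msupp (p.1 * p.2)) s); last first.
  have /eqP := congr1 (mcoeff m) eq_m; rewrite mcoeffX eqxx raddf_sum /=.
  rewrite big_seq big1 ?oner_eq0 // => p /s0.
  by rewrite mcoeff_msupp negbK => /eqP.
have [m' [m'_f ne_m' eq_m']] := toric_ideal_fibre f_I m0_f.
exists m0, m'; split=> //; last exact: lead_f.
move: pm; rewrite (perm_mem (msuppMX _ _)) => /mapP [m1 _ ->].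
exact: lem_addr.
Qed.

Lemma minimal_generator_fibre m : minimal_generator (initial_ideal I) m ->
  (exists m', [/\ weight gens m' = weight gens m, degrevlex_lt m' m & standard m'])
  /\ forall m0, (m0 <= m)%MM -> m0 != m -> standard m0.
Proof.
move=> [J_m min_m]; split.
  have [m0 [m' [le_m0 eq_m' lt_m']]] := initial_ideal_fibre J_m.
  have eq_m0 := min_m _ (binomial_initial eq_m' lt_m') le_m0.
  by rewrite eq_m0 in eq_m' lt_m'; apply: exists_standard lt_m'.
move=> m0 le_m0 ne_m0 m' eq_m'; apply: contra ne_m0 => lt_m'.
by apply/eqP/min_m => //; apply: binomial_initial lt_m'.
Qed.

End ToricFibres.

(** * The codimension is at most c *)

Section CodimensionBound.

Lemma kernel_prime (R S : idomainType) (f : {rmorphism R -> S}) :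
  prime_ideal [pred x | f x == 0].
Proof.
split; last first.
  by move=> x y; rewrite !inE rmorphM mulf_eq0.
split; rewrite ?inE ?rmorph0 ?rmorph1 ?oner_eq0 //.
by move=> x u v /eqP fu /eqP fv; rewrite inE rmorphD rmorphM fu fv mulr0 addr0.
Qed.

Variables (K : fieldType) (c d alpha : nat) (a : 'I_c -> 'X_{1..d}).
Hypothesis alpha_gt0 : (0 < alpha)%N.

(** The substitution t_1 = ... = t_k = 0. *)
Definition kill_below (k : nat) : {mpoly K[d]} -> {mpoly K[d]} :=
  comp_mpoly [tuple if (j < k)%N then 0 else 'X_j | j < d].

Lemma kill_below_step k f : kill_below k.+1 (kill_below k f) = kill_below k.+1 f.
Proof.
rewrite /kill_below !(comp_mpolyEX f) raddf_sum.
apply: eq_bigr => m _; rewrite /= comp_mpolyZ; congr (_ *: _).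
rewrite !comp_mpolyX rmorph_prod; apply: eq_bigr => j _ /=.
rewrite rmorphXn /=; congr (_ ^+ _); rewrite !tnth_mktuple.
case: ltnP => [lt_jk|le_kj]; first by rewrite comp_mpoly0 ltnW.
by rewrite comp_mpolyXU -tnth_nth tnth_mktuple.
Qed.

(** The kernels of the maps to K[t_1, ..., t_d] followed by t_1 = ... = t_k = 0,
    for k = 0, ..., d, form a chain of primes: y_(k+1) maps to t_(k+1) ^ alpha, so
    it separates each from the next. *)
Lemma codimension_le k : codimension (toric_ideal K alpha a) k -> (k <= c)%N.
Proof.
case=> r [_ max_r] eq_kr.
pose P k : {pred {mpoly K[c + d]}} := [pred f | kill_below k (toric_map alpha a f) == 0].
suff /max_r : prime_chain (toric_ideal K alpha a) d P by lia.
split.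
- by move=> f /eqP f0; rewrite inE f0 /kill_below comp_mpoly0.
- move=> i _; exact: (kernel_prime (comp_mpoly _ \o comp_mpoly _)).
move=> i lt_id; split.
  move=> f /eqP f0; apply/eqP.
  by rewrite -kill_below_step f0 /kill_below comp_mpoly0.
pose j := Ordinal lt_id.
have y_j l : kill_below l (toric_map alpha a 'X_(rshift c j)) =
    (if (i < l)%N then 0 else 'X_j) ^+ alpha.
  rewrite /toric_map comp_mpolyXU -tnth_nth tnth_mktuple /generators.
  rewrite (unsplitK (inr j)) -mpolyXn /kill_below rmorphXn /=.
  by rewrite comp_mpolyXU -tnth_nth tnth_mktuple.
exists 'X_(rshift c j); rewrite inE y_j ?ltnSn ?ltnn.
  by rewrite expr0n gtn_eqF.
by rewrite expf_eq0 alpha_gt0 -msupp_eq0 msuppX.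
Qed.

End CodimensionBound.

(** * Degrees of the minimal generators *)

(** Since a_i has degree alpha, an entry alpha would make it some e_j. *)
Lemma generator_lt (c d alpha : nat) (a : 'I_c -> 'X_{1..d}) :
  (forall i, mdeg (a i) = alpha) -> injective (generators alpha a) ->
  forall i j, (a i j < alpha)%N.
Proof.
move=> a_deg gens_inj i j; rewrite ltnNge; apply/negP => le_aij.
have le_a : (U_(j) *+ alpha <= a i)%MM.
  by apply/mnm_lepP => k; rewrite mulmnE mnm1E; case: eqP => [<-|]; rewrite ?mul1n.
have eq_a : a i = (U_(j) *+ alpha)%MM.
  rewrite -(submK le_a) -[RHS]add0m; congr (_ + _)%MM; apply/eqP.
  by rewrite -mdeg_eq0 mdegB_lep // a_deg mdegMn mdeg1 mul1n subnn.
have /gens_inj /(congr1 val) /= : generators alpha a (lshift d i) = generators alpha a (rshift c j).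
  by rewrite /generators (unsplitK (inl i)) (unsplitK (inr j)).
by have := ltn_ord i; lia.
Qed.

(** With m = x^u y^v and its standard companion x^u' y^v', either v = 0 and
    removing one letter from u leaves an Apery word, or u and u' are both
    Apery words and deg m < |u| + |u'|. *)
Lemma minimal_generator_mdeg (K : fieldType) (c d alpha : nat)
    (a : 'I_c -> 'X_{1..d}) m : (1 < alpha)%N -> (alpha < d)%N ->
  (forall i, mdeg (a i) = alpha) -> injective (generators alpha a) ->
  minimal_generator (initial_ideal (toric_ideal K alpha a)) m ->
  (c + mdeg m <= (alpha ^ d.-1).+1)%N.
Proof.
move=> alpha_gt1 alpha_lt a_deg gens_inj.
have alpha_gt0 := ltnW alpha_gt1.
have d_gt0 : (0 < d)%N by apply: leq_ltn_trans alpha_lt.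
have a_lt := generator_lt a_deg gens_inj.
have a_inj : injective a.
  move=> i k eq_ik; apply: (@lshift_inj _ d); apply: gens_inj.
  by rewrite /generators (unsplitK (inl i)) (unsplitK (inl k)).
have bound1 := apery_mdeg alpha_gt1 d_gt0 a_deg a_inj a_lt.
have bound2 z := apery_mdeg2 alpha_gt1 d_gt0 a_deg a_inj a_lt alpha_lt (z := z).
move=> /(minimal_generator_fibre alpha_gt0 a_deg) [[m' [eq_m' lt_m' std_m']] std_m].
set u := xpart m; set v := ypart m; have eq_m := joinmK m; rewrite -/u -/v in eq_m.
set u' := xpart m'; set v' := ypart m'; have eq_m2 := joinmK m'.
rewrite -/u' -/v' in eq_m2.
have deg_m : mdeg m = (mdeg u + mdeg v)%N by rewrite -eq_m mdeg_joinm.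
have ap_u' : apery alpha a u' by apply: standard_apery.
have ap_below m0 : (m0 <= m)%MM -> m0 != m -> apery alpha a (xpart m0).
  by move=> le_m0 ne_m0; apply: standard_apery => //; apply: std_m.
have [v0|v_gt0] := posnP (mdeg v).
  have [u0|u_gt0] := posnP (mdeg u).
    by have := bound1 u' ap_u'; lia.
  have [i ui] := exists_letter u_gt0.
  have mi : m (lshift d i) != 0%N by move: ui; rewrite mnmE.
  have le_mi : (U_(lshift d i) <= m)%MM by rewrite lep1mP.
  have := bound1 _ (ap_below (m - U_(lshift d i))%MM (lem_subr _ _) _).
  have -> : xpart (m - U_(lshift d i))%MM = (u - U_(i))%MM.
    apply/mnmP => k; rewrite mnmBE ![xpart _ _]mnmE mnmBE !mnm1E.
    by rewrite (inj_eq (@lshift_inj _ _)).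
  rewrite mdegB_lep ?lep1mP // mdeg1 => bound_u.
  have {}bound_u : (c + (mdeg u - 1) <= alpha ^ d.-1)%N.
    apply: bound_u; apply/negP => /eqP /(congr1 (@mdeg _)).
    by rewrite mdegB_lep // mdeg1 deg_m; lia.
  by lia.
have ap_u : apery alpha a u.
  rewrite -(xpart_joinm u (0%MM : 'X_{1..d})); apply: ap_below.
    apply/mnm_lepP => k; rewrite -eq_m -(splitK k).
    by case: (split k) => i /=; rewrite ?joinmEl ?joinmEr ?mnm0E.
  apply/negP => /eqP /(congr1 (@mdeg _)).
  by rewrite mdeg_joinm mdeg0 deg_m; lia.
(* A common variable could be cancelled, against the minimality of m. *)
have coprime_m k : m k != 0%N -> m' k = 0%N.
  move=> mk; apply/eqP/negPn/negP => mk'.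
  have le_m : (U_(k) <= m)%MM by rewrite lep1mP.
  have le_m' : (U_(k) <= m')%MM by rewrite lep1mP.
  have ne_m : (m - U_(k))%MM != m.
    apply/negP => /eqP /mnmP /(_ k); rewrite mnmBE mnm1E eqxx; lia.
  have /negP : ~~ degrevlex_lt (m' - U_(k))%MM (m - U_(k))%MM.
    apply: (std_m _ (lem_subr _ _) ne_m).
    apply: (@addIm _ (weight (generators alpha a) U_(k)%MM)).
    by rewrite -!weightD !submK.
  by apply; rewrite -(degrevlex_add2r U_(k)%MM) !submK.
have eq_w : (weight a u + v *+ alpha = weight a u' + v' *+ alpha)%MM.
  by rewrite -!weight_joinm eq_m eq_m2.
have le_v : (v *+ alpha <= weight a u')%MM.
  apply/mnm_lepP => j; have [vj|/negPn/eqP vj] := boolP (v j != 0%N).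
    have v'j : v' j = 0%N by rewrite mnmE coprime_m //; move: vj; rewrite mnmE.
    move/mnmP/(_ j): eq_w; rewrite !mnmDE !mulmnE v'j mul0n addn0 => <-.
    exact: leq_addl.
  by rewrite mulmnE vj mul0n.
(* In case of equality the image of x^u' would be alpha v, against [ap_u']. *)
have lt_v : (mdeg v < mdeg u')%N.
  have := mdeg_weight a_deg u'; rewrite -(submK le_v) mdegD mdegMn.
  have [rest0|] := posnP (mdeg (weight a u' - v *+ alpha)%MM); last by nia.
  move/eqP: rest0; rewrite mdeg_eq0 => /eqP rest0.
  have v0 : v = 0%MM.
    by apply: (ap_u' 0%MM); rewrite weight0 -rest0 submK.
  by rewrite v0 mdeg0 in v_gt0.
have := bound2 u ap_u; have := bound2 u' ap_u'; lia.
Qed.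

Theorem proposition2p4 (K : fieldType) (c alpha d : nat)
    (a : 'I_c -> 'X_{1..d})
    (c_ge2 : (2 <= c)%N) (alpha_ge2 : (2 <= alpha)%N)
    (a_deg : forall i, mdeg (a i) = alpha)
    (A_distinct : injective (generators alpha a))
    (a_coprime : \big[gcdn/0%N]_(i < c) \big[gcdn/0%N]_(j < d) a i j = 1%N)
    (degKS codimKS : nat)
    (degKS_def : multiplicity (toric_ideal K alpha a) degKS)
    (codimKS_def : codimension (toric_ideal K alpha a) codimKS)
    (degKS_eq : degKS = (alpha ^ (d - 1))%N)
    (alpha_le : (alpha <= d - 1)%N) :
  forall m : 'X_{1..(c + d)},
    minimal_generator (initial_ideal (toric_ideal K alpha a)) m ->
    (mdeg m)%:Z <= degKS%:Z - codimKS%:Z + 1.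
Proof.
move=> m /minimal_generator_mdeg bound_m.
have alpha_lt : (alpha < d)%N by lia.
have {bound_m} := bound_m alpha_ge2 alpha_lt a_deg A_distinct.
have := codimension_le (ltnW alpha_ge2) codimKS_def.
rewrite -subn1 -degKS_eq; lia.
Qed.
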